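(* Let $H,K$ be subgroups of a residually finite group $G$. Then the following are equivalent: (a) the double coset $HK$ is separable in $G$ and $\overline{H} \cap \overline{K}=\overline{H \cap K}$ in the profinite completion $\widehat{G}$; (b) for every finite index subgroup $L$ of $G$ with $H \cap K \subseteq L$, the double coset $(H \cap L)K$ is separable in $G$.
   Context: $\widehat{G}$ denotes the profinite completion of $G$, i.e. the inverse limit of the finite quotients $G/N$ over all finite index normal subgroups $N$ of $G$; since $G$ is residually finite, $G$ is regarded as a subgroup of $\widehat{G}$ via the natural embedding. For a subset $S \subseteq G$, $\overline{S}$ denotes the closure of $S$ in $\widehat{G}$. The profinite topology on $G$ is the topology induced from $\widehat G$; equivalently, the finite index normal subgroups of $G$ form a basis of open neighborhoods of the identity. A subset $S \subseteq G$ is separable in $G$ if it is closed in the profinite topology on $G$, i.e. $S=\overline{S}\cap G$. For subsets $A,B \subseteq G$, $AB=\{ab \mid a \in A,\ b \in B\}$. *)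

(* Defs.v *)
From HB Require Import structures.
From mathcomp Require Import all_boot all_classical.
From mathcomp Require Import topology function_spaces.

Set Implicit Arguments.
Unset Strict Implicit.
Unset Printing Implicit Defensive.

Local Open Scope classical_set_scope.
Local Open Scope quotient_scope.
Local Open Scope group_scope.

Section Subgroups.
Variable G : groupType.
Implicit Types H K L : set G.

Definition subgroup H : Prop := group_closed [in H].

Lemma subgroupP H :
  subgroup H <-> H 1 /\ (forall x y, H x -> H y -> H (x / y)).
Proof.
split=> [[H1 HB]|[H1 HB]]; split.
- exact: set_mem H1.
- by move=> x y Hx Hy; apply/set_mem/HB; apply: mem_set.
- exact: mem_set H1.
- by move=> x y /set_mem Hx /set_mem Hy; apply/mem_set/HB.
Qed.

Definition finite_index L : Prop :=
  finite_set (range (fun g : G => [set g * l | l in L])).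

Definition setmulg H K : set G := [set h * k | h in H & k in K].

Record fin_normal := FinNormal {
  carrier :> set G;
  fin_normal_subgroup : subgroup carrier;
  fin_normal_conj : forall n g, carrier n -> carrier (n ^ g);
  fin_normal_index : finite_index carrier }.

HB.instance Definition _ := gen_eqMixin fin_normal.
HB.instance Definition _ := gen_choiceMixin fin_normal.

Definition residually_finite : Prop :=
  forall g : G, g <> 1 -> exists N : fin_normal, ~ carrier N g.

End Subgroups.

Section Quotient.
Variables (G : groupType) (N : fin_normal G).

Fact fin_normal1 : carrier N 1.
Proof. by have /subgroupP[] := fin_normal_subgroup N. Qed.

Fact fin_normalB x y : carrier N x -> carrier N y -> carrier N (x / y).
Proof. by have /subgroupP[_] := fin_normal_subgroup N; apply. Qed.

Fact fin_normalV x : carrier N x -> carrier N x^-1.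
Proof. by move=> Nx; rewrite -div1g; exact: (fin_normalB fin_normal1). Qed.

Fact fin_normalM x y : carrier N x -> carrier N y -> carrier N (x * y).
Proof. by move=> Nx /fin_normalV Ny; rewrite -[y]invgK; exact: fin_normalB. Qed.

Definition coset_rel : rel G := fun x y => `[< carrier N (x^-1 * y) >].

Fact coset_rel_refl : reflexive coset_rel.
Proof. by move=> x; apply/asboolP; rewrite mulVg; exact: fin_normal1. Qed.

Fact coset_rel_sym : symmetric coset_rel.
Proof.
by move=> x y; apply/asboolP/asboolP => /fin_normalV; rewrite invgM invgK.
Qed.

Fact coset_rel_trans : transitive coset_rel.
Proof.
move=> y x z /asboolP Nxy /asboolP Nyz; apply/asboolP.
by have := fin_normalM Nxy Nyz; rewrite mulgA mulgK.
Qed.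

Canonical coset_equiv :=
  EquivRel coset_rel coset_rel_refl coset_rel_sym coset_rel_trans.

Definition quot := {eq_quot coset_equiv}.

HB.instance Definition _ := Choice.on quot.
HB.instance Definition _ := Quotient.on quot.
HB.instance Definition _ := EqQuotient.on quot.

Lemma quot_eqP (x y : G) : \pi_quot x = \pi_quot y <-> carrier N (x^-1 * y).
Proof.
split=> [/eqmodP/asboolP //|Nxy]; exact/eqmodP/asboolP.
Qed.

Lemma quot_surj (a : quot) : exists x : G, a = \pi_quot x.
Proof. by exists (repr a); rewrite reprK. Qed.

Definition quot_mul (a b : quot) : quot := \pi_quot (repr a * repr b).
Definition quot_inv (a : quot) : quot := \pi_quot ((repr a)^-1).

Lemma quot_piM (x y : G) : \pi_quot (x * y) = quot_mul (\pi_quot x) (\pi_quot y).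
Proof.
apply/quot_eqP; case: (piP quot x) => x' /quot_eqP Nx.
case: (piP quot y) => y' /quot_eqP Ny.
have -> : (x * y)^-1 * (x' * y') = (x^-1 * x') ^ y * (y^-1 * y').
  by rewrite conjgE invgM !mulgA mulgK.
exact/fin_normalM/Ny/fin_normal_conj.
Qed.

Lemma quot_piV (x : G) : \pi_quot x^-1 = quot_inv (\pi_quot x).
Proof.
apply/quot_eqP; case: (piP quot x) => x' /quot_eqP Nx.
have -> : x^-1^-1 * x'^-1 = ((x^-1 * x')^-1) ^ x^-1.
  by rewrite conjgE invgM !invgK !mulgA mulgK.
exact/fin_normal_conj/fin_normalV.
Qed.

Fact quot_mulA : associative quot_mul.
Proof.
move=> a b c; have [x ->] := quot_surj a; have [y ->] := quot_surj b.
by have [z ->] := quot_surj c; rewrite -!quot_piM mulgA.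
Qed.

Fact quot_mul1g : left_id (\pi_quot 1) quot_mul.
Proof. by move=> a; have [x ->] := quot_surj a; rewrite -quot_piM mul1g. Qed.

Fact quot_mulg1 : right_id (\pi_quot 1) quot_mul.
Proof. by move=> a; have [x ->] := quot_surj a; rewrite -quot_piM mulg1. Qed.

Fact quot_mulVg : left_inverse (\pi_quot 1) quot_inv quot_mul.
Proof. by move=> a; have [x ->] := quot_surj a; rewrite -quot_piV -quot_piM mulVg. Qed.

Fact quot_mulgV : right_inverse (\pi_quot 1) quot_inv quot_mul.
Proof. by move=> a; have [x ->] := quot_surj a; rewrite -quot_piV -quot_piM mulgV. Qed.

HB.instance Definition _ :=
  isGroup.Build quot quot_mulA quot_mul1g quot_mulg1 quot_mulVg quot_mulgV.

HB.instance Definition _ := hasNbhs.Build quot principal_filter.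
HB.instance Definition _ := Discrete_ofNbhs.Build quot erefl.

End Quotient.

Section Completion.
Variable G : groupType.
Implicit Types M N : fin_normal G.

(* The canonical projection G/M -> G/N; only meaningful when M `<=` N. *)
Definition quot_proj M N (c : quot M) : quot N := \pi_(quot N) (repr c).

Lemma quot_proj_pi M N (x : G) :
  M `<=` N -> quot_proj N (\pi_(quot M) x) = \pi_(quot N) x.
Proof.
move=> MN; rewrite /quot_proj; case: (piP (quot M) x) => y /quot_eqP Mxy.
by apply/esym/quot_eqP/MN.
Qed.

Lemma quot_projM M N (a b : quot M) :
  M `<=` N -> quot_proj N (a * b) = quot_proj N a * quot_proj N b.
Proof.
move=> MN; have [x ->] := quot_surj a; have [y ->] := quot_surj b.
by rewrite -[LHS]/(quot_proj N (quot_mul _ _)) -quot_piM !quot_proj_pi ?quot_piM.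
Qed.

Lemma quot_projV M N (a : quot M) :
  M `<=` N -> quot_proj N a^-1 = (quot_proj N a)^-1.
Proof.
move=> MN; have [x ->] := quot_surj a.
by rewrite -[LHS]/(quot_proj N (quot_inv _)) -quot_piV !quot_proj_pi ?quot_piV.
Qed.

Definition compatible : set (prod_topology (fun N : fin_normal G => quot N)) :=
  [set x | forall M N, M `<=` N -> quot_proj N (x M) = x N].

(* The inverse limit of the G/N, with the subspace topology of the product. *)
Definition profinite_completion : Type := set_type compatible.

HB.instance Definition _ := Topological.on profinite_completion.

Definition coord (x : profinite_completion) N : quot N := set_val x N.

Lemma coord_proj (x : profinite_completion) M N :
  M `<=` N -> quot_proj N (coord x M) = coord x N.
Proof. exact: set_valP x M N. Qed.

Definition mkcompl (x : forall N, quot N)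
    (cx : forall M N, M `<=` N -> quot_proj N (x M) = x N) :
  profinite_completion := SigSub (mem_set (cx : compatible x)).

Lemma coord_inj (x y : profinite_completion) :
  (forall N, coord x N = coord y N) -> x = y.
Proof. by move=> xy; apply/val_inj/functional_extensionality_dep. Qed.

Fact compatible1 M N : M `<=` N -> quot_proj N (1 : quot M) = 1.
Proof. exact: (@quot_proj_pi M N 1). Qed.

Fact compatibleM x y M N : M `<=` N ->
  quot_proj N (coord x M * coord y M) = coord x N * coord y N.
Proof. by move=> MN; rewrite quot_projM // !coord_proj. Qed.

Fact compatibleV x M N : M `<=` N ->
  quot_proj N (coord x M)^-1 = (coord x N)^-1.
Proof. by move=> MN; rewrite quot_projV // coord_proj. Qed.

Definition compl_one := mkcompl compatible1.
Definition compl_mul x y := mkcompl (compatibleM x y).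
Definition compl_inv x := mkcompl (compatibleV x).

Fact compl_mulA : associative compl_mul.
Proof. by move=> x y z; apply: coord_inj => N; exact: mulgA. Qed.

Fact compl_mul1g : left_id compl_one compl_mul.
Proof. by move=> x; apply: coord_inj => N; exact: mul1g. Qed.

Fact compl_mulg1 : right_id compl_one compl_mul.
Proof. by move=> x; apply: coord_inj => N; exact: mulg1. Qed.

Fact compl_mulVg : left_inverse compl_one compl_inv compl_mul.
Proof. by move=> x; apply: coord_inj => N; exact: mulVg. Qed.

Fact compl_mulgV : right_inverse compl_one compl_inv compl_mul.
Proof. by move=> x; apply: coord_inj => N; exact: mulgV. Qed.

HB.instance Definition _ := isGroup.Build profinite_completion
  compl_mulA compl_mul1g compl_mulg1 compl_mulVg compl_mulgV.

Definition to_completion (g : G) : profinite_completion :=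
  @mkcompl (fun N => \pi_(quot N) g) (fun M N => @quot_proj_pi M N g).

Lemma to_completionM : {morph to_completion : x y / x * y}.
Proof. by move=> x y; apply: coord_inj => N; exact: quot_piM. Qed.

Lemma to_completion_inj : residually_finite G -> injective to_completion.
Proof.
move=> rfG x y xy; apply/eqP; rewrite -(inj_eq (mulgI x^-1)) mulVg eq_sym.
apply/eqP; apply: contrapT => /rfG[N]; apply.
by apply/quot_eqP; rewrite -[LHS]/(coord (to_completion x) N) xy.
Qed.

(* The closure in the completion of a subset S of G, identified with its image
   under to_completion (injective when G is residually finite). *)
Definition cl (S : set G) : set profinite_completion :=
  closure (to_completion @` S).

Definition profinite_topology : Type := initial_topology to_completion.

HB.instance Definition _ := Topological.on profinite_topology.

Definition separable (S : set G) : Prop := @closed profinite_topology S.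

Lemma separableP (S : set G) : separable S <-> S = to_completion @^-1` cl S.
Proof.
have cti : continuous (to_completion : profinite_topology -> _).
  exact: initial_continuous.
split=> [clS|->]; last first.
  by apply: closed_comp; [move=> x _; exact: cti|exact: closed_closure].
have : @open profinite_topology (~` S) by rewrite openC.
case=> A oA AS; apply/seteqP; split=> [x Sx|x clSx].
  by apply: subset_closure; exists x.
apply: contrapT => nSx; have Ax : A (to_completion x).
  by rewrite -[A _]/((to_completion @^-1` A) x) AS.
have [_ [[y Sy <-] Ay]] := clSx _ (open_nbhs_nbhs (conj oA Ax)).
by have : (~` S) y by rewrite -AS.
Qed.

End Completion.

(* Main.v *)
Require Import Defs.
From mathcomp Require Import all_boot finmap all_classical.
From mathcomp Require Import topology function_spaces.

Local Open Scope classical_set_scope.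
Local Open Scope quotient_scope.
Local Open Scope group_scope.

(** Write g for the image of an element g of G in the completion, and x_N for
the coordinate of a point x in G/N.  Everything is read off in coordinates: x
lies in the closure of S iff every x_N has a representative in S ([clP]), so S
is separable iff it contains every g that agrees with elements of S modulo each
finite index normal subgroup ([separable_approxP]).

Separability of the double cosets (H `&` L)K from (a): let g be in the closure
of (H `&` L)K.  As HK is separable, g = hk with h in H and k in K, and after
removing k only h in L has to be shown.  Modulo each N, h is a product of an
element of H `&` L and an element of K; by compactness of the completion these
factorizations assemble into a single h = xy with x in the closure of H `&` L
and y in the closure of K ([setmulg_approx]).  Now y = x^-1 h is also in the
closure of H, hence in the closure of H `&` K by hypothesis.  Reduce modulo a
finite index normal subgroup N contained in L ([fin_normal_core]): both x_N and
y_N have representatives in L, so h = xy lies in L.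

The intersection formula from (b): let x lie in both closures, let M be a finite
index normal subgroup, and pick h in H representing x_M.  Apply (b) to
L = (H `&` K)M.  Elements of H and of K that both represent x modulo a subgroup
of M show that h^-1 is a limit of elements of (H `&` L)K, so h^-1 = lk with l in
H `&` L and k in K.  Then k lies in H `&` K, hence in L, so h lies in
L = (H `&` K)M and x_M is represented by an element of H `&` K.  Separability of
HK is the case L = G of (b). *)

(** * Subgroups of finite index *)

Section FiniteIndex.
Context {G : groupType}.
Implicit Types (L H K : set G) (M N : fin_normal G).

Lemma subgroup1 L : subgroup L -> L 1.
Proof. by case/subgroupP. Qed.

Lemma subgroupV L x : subgroup L -> L x -> L x^-1.
Proof. by case/subgroupP=> L1 LB Lx; rewrite -div1g; exact: LB. Qed.

Lemma subgroupM L x y : subgroup L -> L x -> L y -> L (x * y).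
Proof.
move=> sgL Lx Ly; rewrite -[y]invgK.
by case/subgroupP: (sgL) => _; apply=> //; exact: subgroupV.
Qed.

Lemma subgroupT : subgroup [set: G].
Proof. exact/subgroupP. Qed.

Lemma subgroupI H K : subgroup H -> subgroup K -> subgroup (H `&` K).
Proof.
move=> /subgroupP[H1 HB] /subgroupP[K1 KB]; apply/subgroupP; split=> //.
by move=> x y [Hx Kx] [Hy Ky]; split; [exact: HB|exact: KB].
Qed.

Lemma subgroup_mul_normal H M : subgroup H -> subgroup (setmulg H M).
Proof.
move=> sgH; have sgM := fin_normal_subgroup M.
apply/subgroupP; split.
  by exists 1; [exact: subgroup1|exists 1; [exact: subgroup1|rewrite mulg1]].
move=> _ _ [h Hh [m Mm <-]] [h' Hh' [m' Mm' <-]].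
exists (h * h'^-1); first by apply: subgroupM => //; exact: subgroupV.
exists ((m * m'^-1) ^ h'^-1).
  by apply: fin_normal_conj; apply: subgroupM => //; exact: subgroupV.
by rewrite conjgE invgK !invgM !mulgA mulgVK.
Qed.

Lemma fiber_section {I : Type} (f : G -> I) :
  exists r : I -> G, forall g, f (r (f g)) = f g.
Proof.
exists (fun i => xget 1 (f @^-1` [set i])) => g.
by apply: (@xgetPex _ 1 (f @^-1` [set f g])); exists g.
Qed.

(** A finite colouring whose colour classes lie inside left cosets is easier to
combine (by pairing, or by tabulating along representatives) than the set of
cosets itself. *)
Lemma finite_indexP L : subgroup L ->
  finite_index L <-> exists (I : finType) (f : G -> I),
    forall x y, f x = f y -> L (x^-1 * y).
Proof.
move=> sgL; split.
  case/finite_fsetP=> X LX.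
  have cX (g : G) : [set g * l | l in L] \in X.
    by have : [set` X] [set g * l | l in L] by rewrite -LX; exists g.
  exists X, (fun g => [` cX g]%fset) => x y /(congr1 val) /= Exy.
  have : [set y * l | l in L] y by exists 1; rewrite ?mulg1//; exact: subgroup1.
  by rewrite -Exy => -[l Ll <-]; rewrite mulgA mulVg mul1g.
case=> I [f fL]; have [r rK] := fiber_section f.
apply: (@sub_finite_set _ _ ((fun i => [set r i * l | l in L]) @` setT)).
  move=> _ [g _ <-]; exists (f g) => //.
  have rg : L ((r (f g))^-1 * g) by exact: fL.
  apply/seteqP; split=> [_ [l Ll <-]|_ [l Ll <-]].
    exists (((r (f g))^-1 * g)^-1 * l).
      by apply: subgroupM => //; exact: subgroupV.
    by rewrite invgM invgK !mulgA mulgV mul1g.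
  exists ((r (f g))^-1 * g * l); first exact: subgroupM.
  by rewrite !mulgA mulgV mul1g.
exact/finite_image/finite_finset.
Qed.

Lemma finite_indexT : finite_index [set: G].
Proof.
by apply/(finite_indexP _ subgroupT); exists unit, (fun=> tt).
Qed.

Lemma finite_indexS H L : subgroup H -> subgroup L -> H `<=` L ->
  finite_index H -> finite_index L.
Proof.
move=> sgH sgL HL /(finite_indexP _ sgH)[I [f fH]]; apply/finite_indexP => //.
by exists I, f => x y /fH/HL.
Qed.

Definition fin_normalT : fin_normal G :=
  FinNormal subgroupT (fun _ _ _ => I) finite_indexT.

Lemma fin_normalI M N : exists P : fin_normal G, P `<=` M /\ P `<=` N.
Proof.
have [sgM sgN] := (fin_normal_subgroup M, fin_normal_subgroup N).
have sgMN : subgroup (M `&` N) by exact: subgroupI.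
have nMN n g : (M `&` N) n -> (M `&` N) (n ^ g).
  by case=> Mn Nn; split; exact: fin_normal_conj.
suff fMN : finite_index (M `&` N).
  by exists (FinNormal sgMN nMN fMN); split=> x [].
have [I [f fM]] := (finite_indexP _ sgM).1 (fin_normal_index M).
have [J [h hN]] := (finite_indexP _ sgN).1 (fin_normal_index N).
apply/finite_indexP => //; exists (I * J)%type, (fun x => (f x, h x)) => x y.
by case=> /fM Mxy /hN Nxy.
Qed.

(** The normal core works: the coset of g modulo the core is determined by the
way left multiplication by g permutes the finitely many left cosets of L, and
there are finitely many self-maps of a finite set. *)
Lemma fin_normal_core L : subgroup L -> finite_index L ->
  exists N : fin_normal G, N `<=` L.
Proof.
move=> sgL /(finite_indexP _ sgL)[I [f fL]].
pose C := [set x : G | forall g, L (x ^ g)].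
have sgC : subgroup C.
  apply/subgroupP; split=> [g|x y Cx Cy g]; first by rewrite conj1g; exact: subgroup1.
  by rewrite conjMg conjVg; apply: subgroupM => //; exact: subgroupV.
have nC n g : C n -> C (n ^ g) by move=> Cn h; rewrite -conjgM.
suff fC : finite_index C.
  by exists (FinNormal sgC nC fC) => x /(_ 1); rewrite conjg1.
apply/finite_indexP => //; have [r rK] := fiber_section f.
exists {ffun I -> I}, (fun x => [ffun i => f (x * r i)]) => x y /ffunP Exy g.
have rg : L (g^-1 * r (f g)) by apply: fL; rewrite rK.
have := Exy (f g); rewrite !ffunE => /fL Lxy.
have -> : (x^-1 * y) ^ g =
    (g^-1 * r (f g)) * ((x * r (f g))^-1 * (y * r (f g))) * (g^-1 * r (f g))^-1.
  by rewrite conjgE !invgM invgK !mulgA !mulgK.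
by apply: subgroupM => //; [exact: subgroupM|exact: subgroupV].
Qed.

End FiniteIndex.

(** * Closures and compactness in coordinates *)

Section Coordinates.
Context {G : groupType}.
Implicit Types (S : set G) (M N : fin_normal G) (x : profinite_completion G).

Local Notation quot_prod := (prod_topology (fun N : fin_normal G => quot N)).

(** The directed order by reverse inclusion, so that families indexed by the
finite index normal subgroups can be treated as nets. *)
Definition refinement : set_system (fin_normal G) :=
  filter_from setT (fun M => [set N : fin_normal G | N `<=` M]).

Instance refinement_proper : ProperFilter refinement.
Proof.
apply: filter_from_proper; last by move=> M _; exists M => /=.
apply: filter_fromT_filter; first by exists fin_normalT.
move=> M N; have [P [PM PN]] := fin_normalI M N; exists P => Q /= QP.
by split; [exact: subset_trans PM|exact: subset_trans PN].
Qed.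

Lemma nbhs_quot_prod (z : quot_prod) N : nbhs z [set y | y N = z N].
Proof.
apply: (@proj_continuous _ (fun N : fin_normal G => quot N) N z [set z N]).
by rewrite nbhs_principalE.
Qed.

Lemma nbhs_coord x N : nbhs x [set y | coord y N = coord x N].
Proof.
have val_cont : {for x, continuous (set_val : _ -> quot_prod)}.
  exact: initial_continuous.
exact: (val_cont _ (nbhs_quot_prod (set_val x) N)).
Qed.

(** For the converse direction, representatives s_N in S of the coordinates x_N
form a net converging to x: its M-coordinate is constant as soon as N is
contained in M. *)
Lemma clP S x : cl S x <-> forall N, exists2 s, S s & coord x N = \pi_(quot N) s.
Proof.
split=> [clSx N|Sx].
  by have [_ [[s Ss <-] <-]] := clSx _ (nbhs_coord x N); exists s.
have /choice[s sP] N : exists s : G, S s /\ coord x N = \pi_(quot N) s.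
  by have [s] := Sx N; exists s.
move=> B [_ [[A oA <-] Ax] AB].
have cvg_s : (fun N => set_val (to_completion (s N)) : quot_prod) @ refinement
    --> (set_val x : quot_prod).
  apply/cvg_sup => M C [_ [[D _ <-] DxM] DC].
  exists M => // N NM; apply: DC => /=.
  rewrite -[X in D X]/(\pi_(quot M) (s N)) -(quot_proj_pi _ NM).
  by rewrite -(sP N).2 coord_proj.
have [M _ MA] := cvg_s _ (open_nbhs_nbhs (conj oA Ax)).
exists (to_completion (s M)); split; first by exists (s M) => //; exact: (sP M).1.
by apply: AB; apply: (MA M) => /=.
Qed.

Lemma separable_approxP S : separable S <->
  forall g, (forall N, exists2 s, S s & carrier N (s^-1 * g)) -> S g.
Proof.
have clE g : cl S (to_completion g) <->
    forall N, exists2 s, S s & carrier N (s^-1 * g).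
  rewrite clP; split=> gS N; have [s Ss sg] := gS N; exists s => //.
    exact/quot_eqP/esym.
  exact/esym/quot_eqP.
rewrite separableP; split=> [SE g /clE|SE]; first by rewrite {2}SE.
apply/seteqP; split=> g; last by move/clE/SE.
by move=> Sg; apply: subset_closure; exists g.
Qed.

Lemma coord_ldiv x g s N : coord x N = \pi_(quot N) s ->
  coord (x^-1 * to_completion g) N = \pi_(quot N) (s^-1 * g).
Proof. by move=> xN; rewrite quot_piM quot_piV -xN. Qed.

Lemma quot_compact N : compact [set: quot N].
Proof.
apply: finite_compact; have sgN := fin_normal_subgroup N.
have [I [f fN]] := (finite_indexP _ sgN).1 (fin_normal_index N).
have [r rK] := fiber_section f.
apply: (@sub_finite_set _ _ ((fun i => \pi_(quot N) (r i)) @` setT)).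
  move=> a _; have [g ->] := quot_surj a; exists (f g) => //.
  exact/quot_eqP/fN.
exact/finite_image/finite_finset.
Qed.

(** Compactness of the completion, for nets in G indexed by the finite index
normal subgroups.  Tychonoff gives a cluster point in the full product of the
G/N; it is a compatible family because any two of its coordinates are
simultaneously those of some member of the net. *)
Lemma net_cluster (u : fin_normal G -> G) : exists x : profinite_completion G,
  forall M, exists2 N : fin_normal G, N `<=` M & coord x M = \pi_(quot M) (u N).
Proof.
pose v N : quot_prod := set_val (to_completion (u N)).
have cpt := @tychonoff _ (fun N : fin_normal G => quot N) _ quot_compact.
have [p [_ clp]] := cpt (v @ refinement) _ (filterS (fun z _ N => I) filterT).
have near_p M M' : exists N : fin_normal G,
    [/\ N `<=` M, \pi_(quot M) (u N) = p M & \pi_(quot M') (u N) = p M'].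
  have fM : (v @ refinement) (v @` [set N | carrier N `<=` carrier M]).
    by exists M => // N NM; exists N.
  have [_ [[N NM <-] [vM vM']]] :=
    clp _ _ fM (filterI (nbhs_quot_prod p M) (nbhs_quot_prod p M')).
  by exists N.
have pc M N : M `<=` N -> quot_proj N (p M) = p N.
  by have [P [_ <- <-]] := near_p M N; exact: quot_proj_pi.
exists (mkcompl pc) => M; have [N [NM uM _]] := near_p M M.
by exists N.
Qed.

(** In a compact group the product of two closed sets is closed, so the closure
of SK lies in the product of the closures of S and K.  The point x is a cluster
point of the S-factors s in approximations sk of g, and since (sk)^-1 g is
k^-1 (s^-1 g), the K-factors then approximate x^-1 g. *)
Lemma setmulg_approx S (K : set G) g :
  (forall N, exists2 s, setmulg S K s & carrier N (s^-1 * g)) ->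
  exists x, cl S x /\ cl K (x^-1 * to_completion g).
Proof.
move=> Sg.
have /choice[u uP] N : exists s : G,
    S s /\ exists2 k, K k & carrier N (k^-1 * (s^-1 * g)).
  have [_ [s Ss [k Kk <-]] Nskg] := Sg N.
  by exists s; split=> //; exists k => //; rewrite mulgA -invgM.
have [x xu] := net_cluster u; exists x; split; apply/clP => M.
  by have [N _ ->] := xu M; exists (u N) => //; exact: (uP N).1.
have [N NM xM] := xu M; have [_ [k Kk Nk]] := uP N; exists k => //.
by rewrite (coord_ldiv _ g _ _ xM); apply/esym/quot_eqP/NM.
Qed.

End Coordinates.

(** * The two implications *)

Section DoubleCosets.
Context {G : groupType} {H K : set G} (sgH : subgroup H) (sgK : subgroup K).
Implicit Types (L : set G) (M N : fin_normal G).

Lemma separable_restrict L :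
  separable (setmulg H K) -> cl H `&` cl K = cl (H `&` K) ->
  subgroup L -> finite_index L -> H `&` K `<=` L ->
  separable (setmulg (H `&` L) K).
Proof.
move=> sepHK clHK sgL fL HKL; apply/separable_approxP => g gHLK.
have [h Hh [k Kk hkg]] : setmulg H K g.
  apply: (separable_approxP _).1 sepHK _ _ => N.
  have [_ [s [Hs _] [k Kk <-]] Ns] := gHLK N.
  by exists (s * k) => //; exists s => //; exists k.
suff Lh : L h by exists h => //; exists k.
have [x [clx clKxh]] : exists x, cl (H `&` L) x /\ cl K (x^-1 * to_completion h).
  apply: setmulg_approx => N.
  have [_ [s HLs [k' Kk' <-]] Ns] := gHLK N.
  exists (s * (k' * k^-1)).
    by exists s => //; exists (k' * k^-1) => //; apply: subgroupM => //; exact: subgroupV.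
  have := fin_normal_conj k^-1 Ns.
  by rewrite -hkg conjgE !invgM !invgK !mulgA mulgK.
have clHxh : cl H (x^-1 * to_completion h).
  apply/clP => N; have [s [Hs _] xN] := (clP _ _).1 clx N.
  exists (s^-1 * h); first by apply: subgroupM => //; exact: subgroupV.
  exact: coord_ldiv.
have [N NL] := fin_normal_core _ sgL fL.
have [s [_ Ls] xN] := (clP _ _).1 clx N.
have : cl (H `&` K) (x^-1 * to_completion h) by rewrite -clHK.
move=> /clP/(_ N)[c /HKL Lc].
rewrite (coord_ldiv _ h _ _ xN) => /quot_eqP/NL Lshc.
have -> : h = s * c * ((s^-1 * h)^-1 * c)^-1.
  by rewrite !invgM !invgK !mulgA mulgK mulgV mul1g.
by apply: subgroupM => //; [exact: subgroupM|exact: subgroupV].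
Qed.

Lemma closure_meet :
  (forall L, subgroup L -> finite_index L -> H `&` K `<=` L ->
     separable (setmulg (H `&` L) K)) ->
  cl H `&` cl K `<=` cl (H `&` K).
Proof.
move=> sepL x [clHx clKx]; apply/clP => M.
have [h Hh xM] := (clP _ _).1 clHx M.
have sgHK := subgroupI _ _ sgH sgK; have sgM := fin_normal_subgroup M.
pose L := setmulg (H `&` K) M.
have HKL : H `&` K `<=` L.
  by move=> c HKc; exists c => //; exists 1; [exact: subgroup1|rewrite mulg1].
have ML : M `<=` L.
  by move=> m Mm; exists 1; [exact: subgroup1|exists m; rewrite ?mul1g].
have sgL : subgroup L by exact: subgroup_mul_normal.
have fL : finite_index L := finite_indexS _ _ sgM sgL ML (fin_normal_index M).
have [l [Hl Ll] [k Kk lk]] : setmulg (H `&` L) K h^-1.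
  apply: (separable_approxP _).1 (sepL _ sgL fL HKL) _ _ => N.
  have [P [PM PN]] := fin_normalI M N.
  have [h' Hh' xh'] := (clP _ _).1 clHx P.
  have [k' Kk' xk'] := (clP _ _).1 clKx P.
  (* h' = k' modulo N, so h^-1 = (h^-1 h') h'^-1 is (h^-1 h') k'^-1 modulo N;
     and h' = h modulo M, which puts h^-1 h' in L. *)
  exists (h^-1 * h' * k'^-1).
    exists (h^-1 * h'); last by exists k'^-1 => //; exact: subgroupV.
    split; first by apply: subgroupM => //; exact: subgroupV.
    apply/ML/quot_eqP; rewrite -xM -(coord_proj _ PM) xh'.
    exact: quot_proj_pi.
  have Nhk : carrier N (h'^-1 * k') by apply/PN/quot_eqP; rewrite -xh'.
  have := fin_normal_conj h'^-1 Nhk.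
  by rewrite conjgE !invgM !invgK !mulgA mulgV mul1g mulgK.
have Hk : H k.
  have -> : k = l^-1 * h^-1 by rewrite -lk mulKg.
  by apply: subgroupM => //; exact: subgroupV.
have : L h.
  rewrite -[h]invgK; apply: subgroupV => //; rewrite -lk.
  by apply: subgroupM => //; exact: HKL.
case=> c HKc [m Mm cmh]; exists c => //; rewrite xM; apply/quot_eqP.
by rewrite -cmh invgM mulgVK; exact: subgroupV.
Qed.

End DoubleCosets.

Theorem theorem1p1 (G : groupType) (rfG : residually_finite G)
    (H K : set G) (sgH : subgroup H) (sgK : subgroup K) :
  (separable (setmulg H K) /\ cl H `&` cl K = cl (H `&` K)) <->
  (forall L : set G, subgroup L -> finite_index L -> H `&` K `<=` L ->
     separable (setmulg (H `&` L) K)).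
Proof.
split=> [[sepHK clHK] L|sepL]; first exact: separable_restrict.
split.
  by rewrite -[H]setIT; apply: sepL => //; [exact: subgroupT|exact: finite_indexT].
apply/seteqP; split; first exact: closure_meet.
by rewrite subsetI; split; apply: closureS; apply: image_subset => x [].
Qed.
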